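(* Let $n\geq 3$ be an integer and let $p$ be a prime number. Then every pro-$p$ Demushkin group $G$ has the strong vanishing $n$-fold Massey product property with respect to $p$: for all $a_1,\ldots,a_n\in H^1(G,\mathbb Z/p)$ such that $a_i\cup a_{i+1}=0$ for every $1\leq i<n$, the $n$-fold Massey product of $a_1,\ldots,a_n$ vanishes.
   Context: A pro-$p$ group $G$ is a Demushkin group if (1) $\dim_{\mathbb Z/p}H^1(G,\mathbb Z/p)<\infty$; (2) $\dim_{\mathbb Z/p}H^2(G,\mathbb Z/p)=1$; (3) the cup product $H^1(G,\mathbb Z/p)\times H^1(G,\mathbb Z/p)\to H^2(G,\mathbb Z/p)$ is a non-degenerate bilinear form. (Finite groups such as $\mathbb Z/2$ are not excluded.) Massey products. Let $G$ be a profinite group and let $\mathcal C^*$ be the differential graded associative algebra of continuous (inhomogeneous) cochains of $G$ with coefficients in $\mathbb Z/p$ (trivial action), with cup product $\cup$, differential $\delta$, and cohomology $H^*(G,\mathbb Z/p)$. Let $n\geq 2$ and $a_1,\ldots,a_n\in H^1(G,\mathbb Z/p)$. A defining system for the $n$-fold Massey product of $a_1,\ldots,a_n$ is a family of elements $a_{ij}\in\mathcal C^1$, indexed by $1\leq i<j\leq n+1$ with $(i,j)\neq(1,n+1)$, such that $$\delta(a_{ij})=\sum_{k=i+1}^{j-1}a_{ik}\cup a_{kj}$$ and such that $a_{12},a_{23},\ldots,a_{n,n+1}$ represent $a_1,a_2,\ldots,a_n$. The $n$-fold Massey product with respect to this defining system is the class of $\sum_{k=2}^n a_{1k}\cup a_{k,n+1}$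 in $H^2(G,\mathbb Z/p)$. The set $\langle a_1,\ldots,a_n\rangle$ consists of the Massey products with respect to all defining systems, and the $n$-fold Massey product of $a_1,\ldots,a_n$ vanishes if $0\in\langle a_1,\ldots,a_n\rangle$. *)

(* Defs.v *)
From HB Require Import structures.
From mathcomp Require Import all_boot all_algebra.
From mathcomp Require Import generic_quotient.
From mathcomp Require Import all_classical topology function_spaces.

Set Implicit Arguments.
Unset Strict Implicit.
Unset Printing Implicit Defensive.

Import GRing.Theory.
Local Open Scope classical_set_scope.
Local Open Scope quotient_scope.
Local Open Scope card_scope.
Local Open Scope ring_scope.

HB.mixin Record isTopologicalGroup G & Group G & Topological G := {
  mulg_continuous : continuous (fun x : G * G => (x.1 * x.2)%g);
  invg_continuous : continuous (fun x : G => (x^-1)%g)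
}.

#[short(type="topologicalGroupType")]
HB.structure Definition TopologicalGroup :=
  {G of Group G & Topological G & isTopologicalGroup G}.

Definition profinite (G : topologicalGroupType) : Prop :=
  [/\ compact [set: G], hausdorff_space G & totally_disconnected [set: G]].

Definition normal_subgroup (G : groupType) (U : set G) : Prop :=
  [/\ U 1%g, forall x y, U x -> U y -> U (x * y)%g,
      forall x, U x -> U (x^-1)%g & forall x y, U x -> U (x ^ y)%g].

Definition left_cosets (G : groupType) (U : set G) : set (set G) :=
  range (fun x : G => [set (x * u)%g | u in U]).

Definition pro_p (p : nat) (G : topologicalGroupType) : Prop :=
  profinite G /\
  forall U : set G, open U -> normal_subgroup U ->
    exists k : nat, left_cosets U #= `I_(p ^ k)%N.

Section QuotientModule.
Variables (R : pzRingType) (V : lmodType R) (B : submodClosed V).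

Definition eqmod (x y : V) : bool := x - y \in B.

Lemma submodN x : (- x \in B) = (x \in B).
Proof.
have N y : y \in B -> - y \in B by move=> yB; rewrite -scaleN1r rpredZ.
by apply/idP/idP => /N //; rewrite opprK.
Qed.

Lemma eqmod_equiv : equiv_class_of eqmod.
Proof.
split=> [x|x y|y x z]; rewrite /eqmod.
- by rewrite subrr rpred0.
- by rewrite -opprB submodN.
- by move=> xy yz; rewrite -(subrKA y) rpredD.
Qed.

Canonical eqmod_equivRel := EquivRelPack eqmod_equiv.

Definition quotmod := {eq_quot eqmod}.
HB.instance Definition _ := Choice.on quotmod.
HB.instance Definition _ := EqQuotient.on quotmod.

Definition quotmod_class (x : V) : quotmod := \pi_quotmod x.

Lemma quotmod_classE x y :
  (quotmod_class x = quotmod_class y) <-> (x - y \in B).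
Proof. by split=> [/eqmodP|?]; last exact/eqmodP. Qed.

Lemma quotmod_reprK (h : quotmod) : quotmod_class (repr h) = h.
Proof. exact: reprK. Qed.

Lemma quotmod_classK (x : V) : repr (quotmod_class x) - x \in B.
Proof. by apply/quotmod_classE; rewrite quotmod_reprK. Qed.

Definition quotmod_add (a b : quotmod) : quotmod :=
  quotmod_class (repr a + repr b).
Definition quotmod_opp (a : quotmod) : quotmod := quotmod_class (- repr a).
Definition quotmod_scale (c : R) (a : quotmod) : quotmod :=
  quotmod_class (c *: repr a).

Lemma quotmod_addE x y :
  quotmod_add (quotmod_class x) (quotmod_class y) = quotmod_class (x + y).
Proof.
apply/quotmod_classE; rewrite opprD addrACA.
by apply: rpredD; apply: quotmod_classK.
Qed.

Lemma quotmod_oppE x : quotmod_opp (quotmod_class x) = quotmod_class (- x).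
Proof. by apply/quotmod_classE; rewrite -opprD submodN quotmod_classK. Qed.

Lemma quotmod_scaleE c x :
  quotmod_scale c (quotmod_class x) = quotmod_class (c *: x).
Proof. by apply/quotmod_classE; rewrite -scalerBr rpredZ// quotmod_classK. Qed.

Lemma quotmod_ind (P : quotmod -> Prop) :
  (forall x, P (quotmod_class x)) -> forall h, P h.
Proof. by move=> Px h; rewrite -(quotmod_reprK h). Qed.

Lemma quotmod_addA : associative quotmod_add.
Proof.
elim/quotmod_ind=> x; elim/quotmod_ind=> y; elim/quotmod_ind=> z.
by rewrite !quotmod_addE addrA.
Qed.

Lemma quotmod_addC : commutative quotmod_add.
Proof.
elim/quotmod_ind=> x; elim/quotmod_ind=> y.
by rewrite !quotmod_addE addrC.
Qed.

Lemma quotmod_add0 : left_id (quotmod_class 0) quotmod_add.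
Proof. by elim/quotmod_ind=> x; rewrite quotmod_addE add0r. Qed.

Lemma quotmod_addN : left_inverse (quotmod_class 0) quotmod_opp quotmod_add.
Proof.
by elim/quotmod_ind=> x; rewrite quotmod_oppE quotmod_addE addNr.
Qed.

HB.instance Definition _ := GRing.isZmodule.Build quotmod
  quotmod_addA quotmod_addC quotmod_add0 quotmod_addN.

Lemma quotmod_scaleA a b h :
  quotmod_scale a (quotmod_scale b h) = quotmod_scale (a * b) h.
Proof. by elim/quotmod_ind: h => x; rewrite !quotmod_scaleE scalerA. Qed.

Lemma quotmod_scale1 : left_id 1 quotmod_scale.
Proof. by elim/quotmod_ind=> x; rewrite quotmod_scaleE scale1r. Qed.

Lemma quotmod_scaleDr : right_distributive quotmod_scale +%R.
Proof.
move=> a; elim/quotmod_ind=> x; elim/quotmod_ind=> y.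
by rewrite /+%R/= !(quotmod_scaleE, quotmod_addE) scalerDr.
Qed.

Lemma quotmod_scaleDl h : {morph quotmod_scale^~ h : a b / a + b}.
Proof.
move=> a b; elim/quotmod_ind: h => x; rewrite !quotmod_scaleE scalerDl.
exact/esym/quotmod_addE.
Qed.

HB.instance Definition _ := GRing.Zmodule_isLmodule.Build R quotmod
  quotmod_scaleA quotmod_scale1 quotmod_scaleDr quotmod_scaleDl.

Lemma quotmod_class_linear : linear quotmod_class.
Proof.
by move=> c x y; rewrite -quotmod_addE -quotmod_scaleE.
Qed.

HB.instance Definition _ := GRing.isLinear.Build R V quotmod *:%R
  quotmod_class quotmod_class_linear.

End QuotientModule.

(* Cochains have values in 'F_p, which is Z/p when p is prime; 'F_p is given
   the discrete topology and G^n = {ptws 'I_n -> G} the product topology. *)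
Section Cochains.
Variables (p : nat) (G : topologicalGroupType).

Definition continuous_cochain (n : nat) : {pred {ptws 'I_n -> G} -> ('F_p)^o} :=
  fun f => `[< continuous (f : _ -> discrete_topology 'F_p) >].

Lemma continuous_cochainP n (f : {ptws 'I_n -> G} -> ('F_p)^o) :
  reflect (forall x : {ptws 'I_n -> G}, \forall y \near x, f y = f x)
          (f \in @continuous_cochain n).
Proof.
apply: (iffP (asboolP _)) => cf x.
  exact: (cf x _ (@discrete_set1 (discrete_topology 'F_p) (f x))).
by move=> U Ux; apply: (filterS _ (cf x)) => y /= ->; exact: nbhs_singleton Ux.
Qed.

Lemma continuous_cochain_submod n : submod_closed (@continuous_cochain n).
Proof.
split=> [|c f g /continuous_cochainP cf /continuous_cochainP cg];
  apply/continuous_cochainP => x; first by apply: filterE.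
apply: (filterS2 _ _ (cf x) (cg x)) => y fy gy.
by rewrite !fctE fy gy.
Qed.

HB.instance Definition _ n := GRing.isSubmodClosed.Build 'F_p
  ({ptws 'I_n -> G} -> ('F_p)^o)
  (@continuous_cochain n) (@continuous_cochain_submod n).

Record cochain (n : nat) := Cochain {
  cochain_fun :> {ptws 'I_n -> G} -> ('F_p)^o;
  _ : cochain_fun \in @continuous_cochain n
}.

HB.instance Definition _ n := [isSub for @cochain_fun n].
HB.instance Definition _ n := [Choice of cochain n by <:].
HB.instance Definition _ n :=
  [SubChoice_isSubLmodule of cochain n by <:].

(* The i-th inner face multiplies the adjacent arguments x_i and x_(i+1). *)
Definition face (n : nat) (i : 'I_n) (x : {ptws 'I_n.+1 -> G}) :
    {ptws 'I_n -> G} :=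
  fun k =>
    if (k < i)%N then x (widen_ord (leqnSn n) k)
    else if k == i then (x (widen_ord (leqnSn n) k) * x (lift ord0 k))%g
    else x (lift ord0 k).

Definition coboundary_fun n (f : {ptws 'I_n -> G} -> ('F_p)^o)
    (x : {ptws 'I_n.+1 -> G}) : ('F_p)^o :=
  f (fun k => x (lift ord0 k))
  + \sum_(i < n) (-1) ^+ i.+1 * f (face i x)
  + (-1) ^+ n.+1 * f (fun k => x (widen_ord (leqnSn n) k)).

Lemma ptws_continuous (T : topologicalType) n (h : T -> {ptws 'I_n -> G}) :
  (forall k, continuous (fun x => h x k)) -> continuous h.
Proof.
move=> hk x; apply/cvg_sup => k; move: x.
apply/(@continuousP _ (initial_topology (@^~ k))) => A [B oB <-].
by rewrite -comp_preimage; apply: open_comp => // y _; exact: hk.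
Qed.

Lemma continuous_cochain_comp m n (f : cochain m)
    (h : {ptws 'I_n -> G} -> {ptws 'I_m -> G}) :
  (forall k, continuous (fun x => h x k)) ->
  (fun x => f (h x)) \in @continuous_cochain n.
Proof.
case: f => f /= /continuous_cochainP cf hk; apply/continuous_cochainP => x.
exact: (ptws_continuous hk (cf (h x))).
Qed.

Lemma coboundary_continuous n (f : cochain n) :
  coboundary_fun f \in @continuous_cochain n.+1.
Proof.
have projc k : continuous (fun x : {ptws 'I_n.+1 -> G} => x k).
  exact: (@proj_continuous _ (fun=> G) k).
have -> : coboundary_fun f =
    (fun x : {ptws 'I_n.+1 -> G} => f (fun k => x (lift ord0 k)))
    + \sum_(i < n) (-1) ^+ i.+1 *: (fun x => f (face i x))
    + (-1) ^+ n.+1 *: (fun x : {ptws 'I_n.+1 -> G} =>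
         f (fun k => x (widen_ord (leqnSn n) k))).
  by apply/funext => x; rewrite !fctE fct_sumE.
apply: rpredD; [apply: rpredD|apply: rpredZ].
- by apply: continuous_cochain_comp => k; exact: projc.
- apply: rpred_sum => i _; apply: rpredZ.
  apply: continuous_cochain_comp => k; rewrite /face.
  case: (k < i)%N; [exact: projc|case: (k == i); last exact: projc].
  move=> x; apply: (@continuous2_cvg _ _ _ _ _ (nbhs_filter x) _ _
    (fun a b : G => (a * b)%g)); [|exact: projc|exact: projc].
  exact: (@mulg_continuous G (_, _)).
- by apply: continuous_cochain_comp => k; exact: projc.
Qed.

Definition coboundary n (f : cochain n) : cochain n.+1 :=
  Cochain (coboundary_continuous f).

Lemma coboundary_linear n : linear (@coboundary n).
Proof.
move=> c f g; apply/val_inj/funext => x.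
change (coboundary_fun (c *: f + g) x
  = c * coboundary_fun f x + coboundary_fun g x).
have E y : (c *: f + g) y = c * f y + g y by [].
rewrite /coboundary_fun !E.
under eq_bigr do rewrite E mulrDr mulrCA.
by rewrite big_split/= -mulr_sumr !mulrDr (mulrCA _ c) [RHS]addrACA
  (addrACA (c * _) (g _)).
Qed.

HB.instance Definition _ n := GRing.isLinear.Build 'F_p (cochain n)
  (cochain n.+1) *:%R (@coboundary n) (@coboundary_linear n).

Definition cup_fun m n (f : {ptws 'I_m -> G} -> ('F_p)^o)
    (g : {ptws 'I_n -> G} -> ('F_p)^o) (x : {ptws 'I_(m + n) -> G}) : ('F_p)^o :=
  f (fun k => x (lshift n k)) * g (fun k => x (rshift m k)).

Lemma cup_continuous m n (f : cochain m) (g : cochain n) :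
  cup_fun f g \in @continuous_cochain (m + n).
Proof.
have projc k : continuous (fun x : {ptws 'I_(m + n) -> G} => x k).
  exact: (@proj_continuous _ (fun=> G) k).
have /continuous_cochainP cf : (fun x : {ptws 'I_(m + n) -> G} =>
    f (fun k => x (lshift n k))) \in @continuous_cochain (m + n).
  by apply: continuous_cochain_comp => k; exact: projc.
have /continuous_cochainP cg : (fun x : {ptws 'I_(m + n) -> G} =>
    g (fun k => x (rshift m k))) \in @continuous_cochain (m + n).
  by apply: continuous_cochain_comp => k; exact: projc.
apply/continuous_cochainP => x.
apply: (filterS2 _ _ (cf x) (cg x)) => y fy gy.
by rewrite /cup_fun fy gy.
Qed.

Definition cup m n (f : cochain m) (g : cochain n) : cochain (m + n) :=
  Cochain (cup_continuous f g).

Definition is_cocycle n : {pred cochain n} := fun f => coboundary f == 0.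

Lemma is_cocycle_submod n : submod_closed (@is_cocycle n).
Proof.
split=> [|c f g /eqP f0 /eqP g0]; first by rewrite inE linear0.
change (coboundary (c *: f + g) == 0).
by rewrite coboundary_linear f0 g0 scaler0 addr0.
Qed.

HB.instance Definition _ n := GRing.isSubmodClosed.Build 'F_p
  (cochain n) (@is_cocycle n) (@is_cocycle_submod n).

Record cocycle (n : nat) := Cocycle {
  cocycle_cochain :> cochain n;
  cocycleP : cocycle_cochain \in @is_cocycle n
}.

HB.instance Definition _ n := [isSub for @cocycle_cochain n].
HB.instance Definition _ n := [Choice of cocycle n by <:].
HB.instance Definition _ n := [SubChoice_isSubLmodule of cocycle n by <:].

Definition is_coboundary (n : nat) : {pred cocycle n} :=
  match n return {pred cocycle n} with
  | 0 => fun z => z == 0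
  | m.+1 => fun z => `[< exists f : cochain m, coboundary f = z >]
  end.

Lemma is_coboundary_submod n : submod_closed (@is_coboundary n).
Proof.
case: n => [|n]; split=> [|c z w].
- exact: eqxx.
- by move=> /eqP-> /eqP->; rewrite scaler0 addr0; exact: eqxx.
- by apply/asboolP; exists 0; rewrite linear0.
- move=> /asboolP[f fz] /asboolP[g gw]; apply/asboolP.
  by exists (c *: f + g); rewrite coboundary_linear fz gw.
Qed.

HB.instance Definition _ n := GRing.isSubmodClosed.Build 'F_p
  (cocycle n) (@is_coboundary n) (@is_coboundary_submod n).

Definition cohomology (n : nat) := quotmod (@is_coboundary n).
HB.instance Definition _ n := GRing.Lmodule.on (cohomology n).

Definition cohomology_class n (z : cocycle n) : cohomology n :=
  quotmod_class (@is_coboundary n) z.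

Lemma cochain1E (f : cochain 1) (x : {ptws 'I_1 -> G}) :
  f x = f (fun=> x ord0).
Proof. by congr (f _); apply/funext => k; rewrite ord1. Qed.

Lemma coboundary1E (f : cochain 1) (a b : G) :
  coboundary f (fun k : 'I_2 => if k == ord0 then a else b)
  = f (fun=> b) - f (fun=> (a * b)%g) + f (fun=> a).
Proof.
rewrite /= /coboundary_fun big_ord_recl big_ord0 addr0 expr1 sqrrN expr1n.
by rewrite !mulNr !mul1r cochain1E (cochain1E f (face _ _)) [in X in _ + X]cochain1E.
Qed.

Lemma coboundary2E (f : cochain 2) (x : {ptws 'I_3 -> G}) :
  let pair a b : {ptws 'I_2 -> G} := fun k => if k == ord0 then a else b in
  let x0 := x ord0 in let x1 := x (lift ord0 ord0) in let x2 := x ord_max in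
  coboundary f x = f (pair x1 x2) - f (pair (x0 * x1)%g x2)
    + f (pair x0 (x1 * x2)%g) - f (pair x0 x1).
Proof.
move=> pair x0 x1 x2.
have pairE (y : {ptws 'I_2 -> G}) : f y = f (pair (y ord0) (y ord_max)).
  by congr (f _); apply/funext => -[[|[|//]] ?] /=; congr y; exact/val_inj.
rewrite /= /coboundary_fun !big_ord_recl big_ord0 addr0.
rewrite pairE (pairE (face _ _)) (pairE (face (lift _ _) _)) [in X in _ + X]pairE.
have w0 : widen_ord (leqnSn 2) ord0 = ord0 by exact/val_inj.
have w1 : widen_ord (leqnSn 2) ord_max = lift ord0 ord0 by exact/val_inj.
have l1 : lift ord0 ord_max = ord_max :> 'I_3 by exact/val_inj.
rewrite /face /= w0 w1 l1 -/x0 -/x1 -/x2.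
rewrite /bump /= !exprS expr0 !mulr1 !mulN1r !opprK !mul1r.
by rewrite addrA mulN1r.
Qed.


Lemma cup1E (f g : cochain 1) (x : {ptws 'I_2 -> G}) :
  cup f g x = f (fun=> x ord0) * g (fun=> x ord_max).
Proof.
rewrite /= /cup_fun cochain1E (cochain1E g).
have -> : lshift 1 (ord0 : 'I_1) = (ord0 : 'I_(1 + 1)) by exact/val_inj.
by have -> : rshift 1 (ord0 : 'I_1) = (ord_max : 'I_(1 + 1)) by exact/val_inj.
Qed.

Lemma cup_is_cocycle (f g : cocycle 1) : cup f g \in @is_cocycle 2.
Proof.
have mor (h : cocycle 1) a b : h (fun=> (a * b)%g) = h (fun=> a) + h (fun=> b).
  have := coboundary1E h a b; have /eqP-> := cocycleP h => /esym/eqP.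
  by rewrite addrAC subr_eq0 => /eqP <-; rewrite addrC.
apply/eqP/val_inj/funext => x.
change (coboundary (cup f g : cochain 2) x = 0).
rewrite coboundary2E !cup1E /= !mor mulrDl mulrDr.
have E (a b c : ('F_p)^o) : a - (b + a) + (c + b) - c = 0.
  by rewrite opprD (addrCA a) subrr addr0 (addrCA (- b)) addNr addr0 subrr.
exact: E.
Qed.

Definition cup_cocycle (f g : cocycle 1) : cocycle 2 :=
  Cocycle (cup_is_cocycle f g).

(* The choice of representatives is immaterial, see cup_product_class. *)
Definition cup_product (a b : cohomology 1) : cohomology 2 :=
  cohomology_class (cup_cocycle (repr a) (repr b)).

Lemma repr_cohomology_class1 (f : cocycle 1) : repr (cohomology_class f) = f.
Proof.
have /asboolP[h hf] := quotmod_classK (@is_coboundary 1) f.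
have h0 : coboundary h = 0.
  apply/val_inj/funext => x; rewrite /= /coboundary_fun big_ord0 addr0 expr1.
  by rewrite mulN1r; apply/eqP; rewrite subr_eq0; apply/eqP; congr (h _);
    apply/funext => -[].
apply/eqP; rewrite -subr_eq0; apply/eqP/val_inj.
by rewrite -[LHS]hf h0.
Qed.

Lemma cup_product_class (f g : cocycle 1) :
  cup_product (cohomology_class f) (cohomology_class g)
  = cohomology_class (cup_cocycle f g).
Proof. by rewrite /cup_product !repr_cohomology_class1. Qed.

End Cochains.

Definition has_dim (R : nzRingType) (V : lmodType R) (d : nat) : Prop :=
  exists phi : V -> 'rV[R]_d, linear phi /\ bijective phi.

Record demushkin (p : nat) (G : topologicalGroupType) : Prop := {
  demushkin_pro_p : pro_p p G;
  demushkin_H1 : exists d, has_dim (cohomology p G 1) d;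
  demushkin_H2 : has_dim (cohomology p G 2) 1;
  demushkin_nondegl : forall a : cohomology p G 1,
    (forall b, cup_product a b = 0) -> a = 0;
  demushkin_nondegr : forall b : cohomology p G 1,
    (forall a, cup_product a b = 0) -> b = 0
}.

Section Massey.
Variables (p : nat) (G : topologicalGroupType).

Definition represents n (f : cochain p G n) (h : cohomology p G n) : Prop :=
  exists2 z : cocycle p G n, cocycle_cochain z = f & cohomology_class z = h.

(* Only the entries [A i j] with [1 <= i < j <= n.+1] and
   [(i, j) != (1, n.+1)] of the family matter. The index of [a] starts at 0,
   that of [A] at 1. *)
Definition defining_system n (a : 'I_n -> cohomology p G 1)
    (A : nat -> nat -> cochain p G 1) : Prop :=
  (forall i j : nat,
     (1 <= i)%N -> (i < j)%N -> (j <= n.+1)%N -> (i, j) != (1, n.+1)%N ->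
     coboundary (A i j)
     = \sum_(i.+1 <= k < j) (cup (A i k) (A k j) : cochain p G 2))
  /\ (forall i : 'I_n, represents (A i.+1 i.+2) (a i)).

Definition massey_product n (a : 'I_n -> cohomology p G 1) :
    set (cohomology p G 2) :=
  [set h | exists2 A, defining_system a A &
     represents
       (\sum_(2 <= k < n.+1) (cup (A 1%N k) (A k n.+1) : cochain p G 2)) h].

Definition massey_vanishes n (a : 'I_n -> cohomology p G 1) : Prop :=
  massey_product a 0.

End Massey.

Definition strong_massey_vanishing (n p : nat) (G : topologicalGroupType) :
    Prop :=
  forall a : 'I_n -> cohomology p G 1,
    (forall i j : 'I_n, j = i.+1 :> nat -> cup_product (a i) (a j) = 0) ->
    massey_vanishes a.

(* Main.v *)
Require Import Defs.
From HB Require Import structures.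
From mathcomp Require Import all_boot all_algebra.
From mathcomp Require Import all_classical topology function_spaces.
From mathcomp Require Import ring zify.

(** If [a_r <> 0], nondegeneracy and [dim H^2 = 1] make [a_r cup _ : H^1 -> H^2]
    onto.  The entries [A i j] are built column by column, each column from the
    diagonal upwards: once the rows [> r] of a column are filled, the class
    obstructing row [r] is killed by adding a cocycle [x] to row [r.+1], which
    changes that class by [a_r cup x] and leaves the equations of the filled
    rows untouched.  If some [a_m] vanishes, the system splits into blocks: all
    [A i j] with [i <= m < j] can be taken to be zero.  In the resulting system
    the top right entry also exists, and bounds the Massey product. *)

Set Implicit Arguments.
Unset Strict Implicit.
Unset Printing Implicit Defensive.

Import GRing.Theory.
Local Open Scope ring_scope.

Lemma has_dim1_span (F : fieldType) (V : lmodType F) (v w : V) :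
  has_dim V 1 -> v <> 0 -> exists c, w = c *: v.
Proof.
move=> [phi [phiL /bij_inj phiI]] v0.
have phi0 : phi 0 = 0.
  by have := phiL (-1) 0 0; rewrite scaler0 addr0 scaleN1r addNr.
have phiZ c u : phi (c *: u) = c *: phi u.
  by rewrite -[c *: u]addr0 phiL phi0 addr0.
have pv : phi v 0 0 != 0.
  apply/eqP => pv0; apply: v0; apply: phiI; rewrite phi0.
  by apply/rowP => k; rewrite ord1 mxE.
exists (phi w 0 0 / phi v 0 0); apply: phiI; rewrite phiZ.
by apply/rowP => k; rewrite ord1 mxE mulfVK.
Qed.

Section Cochains.
Variables (p : nat) (G : topologicalGroupType).
Implicit Types (u w : nat -> cochain p G 1) (A M : nat -> nat -> cochain p G 1).

Lemma sum_cochainE n i j (F : nat -> cochain p G n) x :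
  (\sum_(i <= k < j) F k) x = \sum_(i <= k < j) F k x.
Proof. by elim/big_rec2: _ => // k y f _ <-. Qed.

Lemma sum_cupE u w i j (x : {ptws 'I_2 -> G}) :
  (\sum_(i <= k < j) (cup (u k) (w k) : cochain p G 2)) x =
  \sum_(i <= k < j) u k (fun=> x ord0) * w k (fun=> x ord_max).
Proof. by rewrite sum_cochainE; apply: eq_bigr => k _; exact: cup1E. Qed.

Lemma cochain1M (f : cochain p G 1) (a b : G) :
  f (fun=> (a * b)%g) = f (fun=> a) + f (fun=> b)
    - coboundary f (fun k : 'I_2 => if k == ord0 then a else b).
Proof. by rewrite coboundary1E; ring. Qed.

Lemma exchange_big_triangle i j (F : nat -> nat -> 'F_p) :
  \sum_(i <= k < j) \sum_(i <= l < k) F l k =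
  \sum_(i <= k < j) \sum_(k.+1 <= l < j) F k l.
Proof.
transitivity (\sum_(i <= k < j) \sum_(i <= l < j | (l < k)%N) F l k).
  by apply: eq_big_nat => k /andP[_ kj]; rewrite (big_nat_widen _ _ j)// ltnW.
rewrite (exchange_big_dep_nat xpredT)//=.
by apply: eq_big_nat => k /andP[ik _]; rewrite [RHS](big_nat_widenl _ i) 1?leqW.
Qed.

(** By the Leibniz rule the coboundary is a difference of two sums of the triple products of [u l],
    [M l k] and [w k] over [l < k]. They agree after exchanging the order of summation. *)
Lemma sum_cup_is_cocycle u w M i j :
  (forall k, (i <= k < j)%N -> coboundary (u k) =
     \sum_(i <= l < k) (cup (u l) (M l k) : cochain p G 2)) ->
  (forall k, (i <= k < j)%N -> coboundary (w k) =
     \sum_(k.+1 <= l < j) (cup (M k l) (w l) : cochain p G 2)) ->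
  \sum_(i <= k < j) (cup (u k) (w k) : cochain p G 2) \in @is_cocycle p G 2.
Proof.
move=> du dw; apply/eqP/val_inj/funext => x; rewrite [RHS]/=.
have E : coboundary (\sum_(i <= k < j) (cup (u k) (w k) : cochain p G 2)) x = 0.
  rewrite coboundary2E !sum_cupE/=.
  set a := x ord0; set b := x (lift ord0 ord0); set c := x ord_max.
  rewrite -!sumrN -!big_split/=.
  transitivity (\sum_(i <= k < j)
    ((\sum_(i <= l < k) u l (fun=> a) * M l k (fun=> b) * w k (fun=> c))
    - \sum_(k.+1 <= l < j) u k (fun=> a) * M k l (fun=> b) * w l (fun=> c))).
    apply: eq_big_nat => k kij; rewrite !cochain1M du// dw// !sum_cupE/=.
    rewrite -mulr_suml; under [in RHS]eq_bigr do rewrite -mulrA.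
    rewrite -mulr_sumr; ring.
  by rewrite sumrB exchange_big_triangle subrr.
exact: E.
Qed.

Lemma cup0l (f : cochain p G 1) : cup (0 : cochain p G 1) f = 0 :> cochain p G 2.
Proof. by apply/val_inj/funext => x; rewrite /= /cup_fun mul0r. Qed.

Lemma cup0r (f : cochain p G 1) : cup f (0 : cochain p G 1) = 0 :> cochain p G 2.
Proof. by apply/val_inj/funext => x; rewrite /= /cup_fun mulr0. Qed.

Lemma cupDr (f g h : cochain p G 1) :
  cup f (g + h) = (cup f g : cochain p G 2) + cup f h.
Proof. by apply/val_inj/funext => x; rewrite /= /cup_fun mulrDr. Qed.

Lemma cupZr c (f g : cochain p G 1) :
  cup f (c *: g) = c *: (cup f g : cochain p G 2).
Proof. by apply/val_inj/funext => x; rewrite /= /cup_fun mulrCA. Qed.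

Lemma cohomology_class_eq0 n (z : cocycle p G n.+1) :
  cohomology_class z = 0 <-> exists f : cochain p G n, coboundary f = z.
Proof.
rewrite -[0]/(quotmod_class (@is_coboundary p G n.+1) 0).
rewrite /cohomology_class quotmod_classE subr0.
by split=> [/asboolP|?]; last exact/asboolP.
Qed.

(** The action is trivial, so 0-cochains have zero coboundary and a class of degree one contains a
    single cocycle. *)
Lemma cohomology_class1_inj : injective (@cohomology_class p G 1).
Proof. by apply: can_inj; exact: repr_cohomology_class1. Qed.

Section System.
Variable a : nat -> cocycle p G 1.

(** Here [u] stands for row [i] and [w] for column [j], so a new column can be tested before it
    joins the matrix. *)
Definition massey_eq u w i j : Prop :=
  coboundary (w i) = \sum_(i.+1 <= k < j) (cup (u k) (w k) : cochain p G 2).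

(* All indices start at 0, and no corner entry is left out. *)
Definition massey_system A m : Prop :=
  [/\ forall i, A i i.+1 = a i,
      forall i j, (i < j < m)%N -> massey_eq (A i) (A^~ j) i j &
      forall i j k, (i <= k < j)%N -> (j < m)%N -> a k = 0 -> A i j = 0].

Hypothesis cup0 : forall i, exists f : cochain p G 1,
  coboundary f = cup (a i) (a i.+1).
Hypothesis cup_onto : forall i, a i <> 0 -> forall z : cocycle p G 2,
  exists (x : cocycle p G 1) (f : cochain p G 1),
    coboundary f = (z : cochain p G 2) + cup (a i) x.

Lemma massey_column A j : massey_system A j.+1 ->
  exists w, [/\ w j = a j, forall i, (i <= j)%N -> massey_eq (A i) w i j.+1 &
    forall i k, (i <= k <= j)%N -> a k = 0 -> w i = 0].
Proof.
move=> [Aa dA A0].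
(* Induction on [d], where the rows from [j - d] down to the diagonal row [j] are filled. *)
suff /(_ j)[w [wj dw w0]] : forall d, exists w, [/\ w j = a j,
    forall i, (j <= i + d)%N -> (i <= j)%N -> massey_eq (A i) w i j.+1 &
    forall i k, (j <= i + d)%N -> (i <= k <= j)%N -> a k = 0 -> w i = 0].
  exists w; split=> // [i|i k]; [apply: dw|apply: w0]; exact: leq_addl.
elim=> [|d [w [wj dw w0]]].
  exists (fun=> a j); split=> // [i|i k]; rewrite addn0 => ji.
    move=> ij; rewrite /massey_eq big_geq ?ltnS//; exact/eqP/cocycleP.
  by move=> ikj; have -> : j = k; [lia|move=> ->].
have [jd|dj] := leqP j d.
  by exists w; split=> // [i _|i k _]; [apply: dw|apply: w0]; lia.
pose r := (j - d.+1)%N; have jE : j = (r + d.+1)%N by rewrite subnK.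
clearbody r.
have [[m rmj am]|an0] := pselect (exists2 m, (r <= m <= j)%N & a m = 0).
  (* Zero works in row [r]: in each product of its equation, [w l] vanishes if [l <= m] and [A r l]
     vanishes if [m < l]. *)
  exists (fun k => if k == r then 0 else w k); split=> [|i ji ij|i k ji ikj ak].
  - by rewrite ifN//; lia.
  - have wE l : (i < l)%N -> (if l == r then 0 else w l) = w l.
      by move=> il; rewrite ifN//; lia.
    rewrite /massey_eq.
    under eq_big_nat => l /andP[il _] do rewrite wE//.
    case: eqP => [ir|/eqP ir]; last by apply: dw; lia.
    rewrite linear0 big_nat_cond big1// => l /andP[/andP[il lj] _].
    have [lm|ml] := leqP l m; first by rewrite (w0 l m) ?cup0r//; lia.
    by rewrite (A0 i l m) ?cup0l//; lia.
  - by case: eqP => // /eqP ir; apply: (w0 i k) => //; lia.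
have zP : \sum_(r.+1 <= k < j.+1) (cup (A r k) (w k) : cochain p G 2)
    \in @is_cocycle p G 2.
  apply: (@sum_cup_is_cocycle _ _ A) => k /andP[rk kj]; first by apply: dA; lia.
  by apply: dw; lia.
(* For [d = 0], row [r.+1] holds the diagonal entry [a j], which must not change; the obstruction is
   then the cup product of [a r] and [a j], a coboundary by [cup0]. Otherwise [cup_onto] applies, as
   [a r] is nonzero. *)
have [x [f [xj df]]] : exists (x : cocycle p G 1) (f : cochain p G 1),
    (d = 0%N -> x = 0) /\ coboundary f =
      (Cocycle zP : cochain p G 2) + cup (a r) x.
  case: (eqVneq d 0%N) => [d0|dn0].
    have [f df] := cup0 r; exists 0, f; split=> //.
    have jr : j = r.+1 by lia.
    by rewrite df cup0r addr0 /= jr big_nat1 Aa -jr wj.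
  have [|x [f df]] := @cup_onto r _ (Cocycle zP).
    by move=> ar; apply: an0; exists r => //; lia.
  by exists x, f; split=> // d0; rewrite d0 in dn0.
pose w' k := if k == r then f else if k == r.+1 then w k + x else w k.
exists w'; split=> [|i ji ij|i k ji ikj ak].
- rewrite /w' ifN; last lia.
  by case: eqP => // jr; rewrite xj ?addr0//; lia.
- have w'E k : (r.+1 < k)%N -> w' k = w k.
    by move=> rk; rewrite /w' !ifN//; lia.
  rewrite /massey_eq.
  have [->|ir] := eqVneq i r.
    rewrite {1}/w' eqxx df /= big_ltn; last lia.
    rewrite [in RHS]big_ltn; last lia.
    rewrite {1}/w' ifN ?eqxx; last lia.
    rewrite Aa cupDr addrAC; congr (_ + _).
    by apply: eq_big_nat => k /andP[rk _]; rewrite w'E.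
  (* For [i > r] the sum only involves rows beyond [r.+1], where [w'] is [w], and adding the cocycle
     [x] leaves the coboundary unchanged. *)
  have -> : coboundary (w' i) = coboundary (w i).
    rewrite /w' (negbTE ir); case: eqP => // _.
    by rewrite linearD /= (eqP (cocycleP x)) addr0.
  rewrite dw//; last lia.
  by apply: eq_big_nat => k /andP[ik _]; rewrite w'E//; lia.
- by case: an0; exists k => //; lia.
Qed.

Lemma massey_system_exists m : exists A, massey_system A m.+1.
Proof.
elim: m => [|j [A Am]].
  (* Only column 0 is in range, and it has no entry above the diagonal; the superdiagonal alone is
     prescribed. *)
  by exists (fun i _ => a i); split=> // [i j|i j k]; lia.
have [w [wj dw w0]] := massey_column Am; case: Am => Aa dA A0.
exists (fun i l => if l == j.+1 then w i else A i l).
split=> [i|i l /andP[il lj]|i l k ikl lj].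
- by rewrite eqSS; case: eqP => [->|].
- rewrite /massey_eq; have [->|lnj] := eqVneq l j.+1.
    rewrite dw; last lia.
    by apply: eq_big_nat => k kj; rewrite ifN//; lia.
  rewrite dA; last lia.
  by apply: eq_big_nat => k kj; rewrite ifN//; lia.
- by case: eqP => lE; [apply: w0; lia|apply: A0 ikl _; lia].
Qed.

End System.

Lemma demushkin_cup_onto (f : cocycle p G 1) (z : cocycle p G 2) :
  demushkin p G -> f <> 0 -> exists (x : cocycle p G 1) (h : cochain p G 1),
    coboundary h = (z : cochain p G 2) + cup f x.
Proof.
move=> GD f0.
have [g fg] : exists g : cocycle p G 1, cohomology_class (cup_cocycle f g) <> 0.
  apply: contrapT => /forallNP fN; apply: f0.
  apply: cohomology_class1_inj; apply: (demushkin_nondegl GD) => b.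
  rewrite -(quotmod_reprK b) cup_product_class; exact: contrapT (fN _).
have [c zE] := has_dim1_span (cohomology_class z) (demushkin_H2 GD) fg.
have /cohomology_class_eq0[h hE] :
    cohomology_class (- c *: cup_cocycle f g + z) = 0.
  transitivity (- c *: cohomology_class (cup_cocycle f g) + cohomology_class z).
    exact: quotmod_class_linear.
  by rewrite zE scaleNr addNr.
(* The class of [z] is [c] times that of the product of [f] and [g], hence the coefficient [- c]. *)
by exists (- c *: g), h; rewrite hE cupZr addrC.
Qed.

End Cochains.

Theorem theorem3p5 (n p : nat) (G : topologicalGroupType)
    (n_ge3 : (3 <= n)%N) (p_prime : prime p) (G_demushkin : demushkin p G) :
  strong_massey_vanishing n p G.
Proof.
move=> a a_cup.
(* Extending by 0 beyond [n] makes the adjacent cup products bound at every natural index. *)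
pose b k : cocycle p G 1 := oapp (fun i : 'I_n => repr (a i)) 0 (insub k).
have bE (i : 'I_n) : b i = repr (a i) by rewrite /b valK.
have b_cup i : exists f : cochain p G 1, coboundary f = cup (b i) (b i.+1).
  have [lt_i|le_i] := ltnP i.+1 n; last first.
    exists 0; rewrite linear0 [b i.+1]/b insubF ?cup0r//.
    by rewrite ltnNge le_i.
  have := a_cup (Ordinal (ltnW lt_i)) (Ordinal lt_i) erefl.
  by rewrite /cup_product -!bE => /cohomology_class_eq0.
have [A [Ab dA _]] := massey_system_exists b_cup
  (fun i bi z => demushkin_cup_onto z G_demushkin bi) n.
have dA' i j : (i < j <= n)%N -> coboundary (A i j) =
    \sum_(i.+2 <= k < j.+1) (cup (A i k.-1) (A k.-1 j) : cochain p G 2).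
  by move=> ij; rewrite big_add1; exact: dA.
(* The predecessors pass from indices starting at 1 to those of [A], which start at 0. *)
exists (fun i j => A i.-1 j.-1); first split.
- move=> [//|i] [|j] // _ ij jn _; apply: dA'; lia.
- move=> i; exists (b i); first by rewrite Ab.
  by rewrite bE; exact: quotmod_reprK.
have zP : \sum_(2 <= k < n.+1)
    (cup (A 0%N k.-1) (A k.-1 n) : cochain p G 2) \in @is_cocycle p G 2.
  apply: (sum_cup_is_cocycle (u := fun k => A 0%N k.-1)
      (w := fun k => A k.-1 n) (M := fun k l => A k.-1 l.-1)) => -[//|k] kn.
    by apply: dA'; lia.
  by apply: dA'; lia.
exists (Cocycle zP) => //.
by apply/cohomology_class_eq0; exists (A 0%N n); apply: dA'; lia.
Qed.
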